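(* Let $(T,[-,-,-],\cdot)$ be a truss and let $P$ be a (non-empty) sub-heap of $(T,[-,-,-])$. Then the quotient heap $T/P$ is a truss such that the canonical epimorphism $T\to T/P$ is a morphism of trusses if and only if $P$ is a paragon.
   Context: A heap is a non-empty set $H$ with a ternary operation $[-,-,-]$ satisfying $[v,w,[x,y,z]]=[[v,w,x],y,z]$ and $[x,x,y]=y=[y,x,x]$; it is Abelian if $[x,y,z]=[z,y,x]$. A sub-heap is a (non-empty) subset closed under $[-,-,-]$. For a sub-heap $S$ of an Abelian heap $H$, the relation $x\sim_S y$ iff there exists $s\in S$ with $[x,y,s]\in S$ is an equivalence relation, and the set $H/S$ of its classes is a heap (the quotient heap) with $[\bar x,\bar y,\bar z]=\overline{[x,y,z]}$; the canonical epimorphism is $x\mapsto\bar x$. A truss is an Abelian heap $T$ with an associative binary operation (juxtaposition) satisfying $w[x,y,z]=[wx,wy,wz]$ and $[x,y,z]w=[xw,yw,zw]$. A morphism of trusses is a function preserving both operations. A sub-heap $P$ of a truss $T$ is a paragon if, for all $x\in T$ and all $p,p'\in P$, $[xp,xp',p']\in P$ and $[px,p'x,p']\in P$. ''The quotient heap $T/P$ is a truss'' means that the quotient heap admits a binary operation making it a truss. *)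

(* Defs.v *)
From HB Require Import structures.
From mathcomp Require Import ssreflect ssrfun ssrbool.
From mathcomp Require Import monoid.
From mathcomp Require Export boolp classical_sets.

Set Implicit Arguments.
Unset Strict Implicit.
Unset Printing Implicit Defensive.

Local Open Scope classical_set_scope.
Local Open Scope group_scope.

Reserved Notation "[ 'hp' x , y , z ]"
  (at level 0, x at level 99, y at level 99, z at level 99,
   format "[ 'hp'  x ,  y ,  z ]").

HB.mixin Record isHeap (H : Type) := {
  heap_op : H -> H -> H -> H;
  heap_nonempty : inhabited H;
  heapA : forall v w x y z,
    heap_op v w (heap_op x y z) = heap_op (heap_op v w x) y z;
  heapKl : forall x y, heap_op x x y = y;
  heapKr : forall x y, heap_op y x x = y;
}.

#[short(type="heapType")]
HB.structure Definition Heap := {H of isHeap H}.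

Notation "[ 'hp' x , y , z ]" := (heap_op x y z).

HB.mixin Record Heap_isAbelian H of Heap H := {
  heapC : forall x y z : H, [hp x, y, z] = [hp z, y, x];
}.

#[short(type="abHeapType")]
HB.structure Definition AbHeap := {H of Heap_isAbelian H & Heap H}.

Definition truss_axioms (H : abHeapType) (mul : H -> H -> H) : Prop :=
  [/\ associative mul,
      forall w x y z, mul w [hp x, y, z] = [hp mul w x, mul w y, mul w z] &
      forall w x y z, mul [hp x, y, z] w = [hp mul x w, mul y w, mul z w]].

(* [hasMul] provides only the binary operation [*]; the library's
   [semigroupType] is not used because it also requires a [choiceType]. *)
HB.mixin Record Magma_AbHeap_isTruss T of hasMul T & AbHeap T := {
  trussP : truss_axioms (@mul T);
}.

#[short(type="trussType")]
HB.structure Definition Truss :=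
  {T of Magma_AbHeap_isTruss T & hasMul T & AbHeap T}.

(* A copy of H that carries, on top of its heap, the multiplication mul. *)
Definition truss_of (H : abHeapType) (mul : H -> H -> H)
  (mulP : truss_axioms mul) : Type := H.

Section TrussOf.
Variables (H : abHeapType) (mul : H -> H -> H) (mulP : truss_axioms mul).

HB.instance Definition _ := AbHeap.copy (truss_of mulP) H.
HB.instance Definition _ := hasMul.Build (truss_of mulP) mul.
HB.instance Definition _ := Magma_AbHeap_isTruss.Build (truss_of mulP) mulP.

End TrussOf.

Definition truss_morphism (S T : trussType) (f : S -> T) : Prop :=
  (forall x y z, f [hp x, y, z] = [hp f x, f y, f z]) /\
  {morph f : x y / x * y}.

Record subHeap (H : heapType) := SubHeap {
  subHeap_set :> H -> Prop;
  subHeap_nonempty : exists x, subHeap_set x;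
  subHeap_closed : forall x y z, subHeap_set x -> subHeap_set y ->
    subHeap_set z -> subHeap_set [hp x, y, z];
}.

Section Quotient.
Variables (H : abHeapType) (S : subHeap H).
Implicit Types x y z s t : H.

Definition subHeap_rel x y : Prop := exists2 s, S s & S [hp x, y, s].

(* The equivalence class of x; elements of [quotient] are these subsets. *)
Definition coset x : set H := [set y | subHeap_rel x y].

Definition quotient : Type := {A : set H | range coset A}.

Definition quotient_pi x : quotient :=
  exist _ (coset x) (ex_intro2 _ _ x I erefl).

Lemma subHeap_rel_all x y t : subHeap_rel x y -> S t -> S [hp x, y, t].
Proof.
move=> [s Ss Sxys] St.
by rewrite -(heapKl s t) heapA; apply: subHeap_closed.
Qed.

Lemma subHeap_rel_refl x : subHeap_rel x x.
Proof. by have [s Ss] := subHeap_nonempty S; exists s; rewrite ?heapKl. Qed.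

Lemma subHeap_rel_sym x y : subHeap_rel x y -> subHeap_rel y x.
Proof.
move=> [s Ss Sxys]; exists [hp x, y, s] => //.
by rewrite heapA heapKr heapKl.
Qed.

Lemma subHeap_rel_trans x y z :
  subHeap_rel x y -> subHeap_rel y z -> subHeap_rel x z.
Proof.
move=> xy [s Ss Syzs]; exists s => //.
by rewrite -(heapKr y x) -heapA; apply: subHeap_rel_all.
Qed.

Lemma quotient_piP x y : quotient_pi x = quotient_pi y <-> subHeap_rel x y.
Proof.
split=> [/(congr1 sval) /= exy|xy].
  by have : coset y y := subHeap_rel_refl y; rewrite -exy.
apply: eq_exist => /=; apply/seteqP; split=> z /=.
  exact/subHeap_rel_trans/subHeap_rel_sym.
exact: subHeap_rel_trans.
Qed.

Lemma quotient_pi_surj (A : quotient) : exists x, quotient_pi x = A.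
Proof. by case: A => A [x ? xA]; exists x; apply: eq_exist. Qed.

Let heap_mid a b c d e :
  [hp a, [hp b, c, d], e] = [hp [hp a, d, c], b, e] :> H.
Proof.
have aE : [hp [hp a, d, c], b, [hp b, c, d]] = a.
  by rewrite heapA heapKr -heapA heapKl heapKr.
by rewrite -[in LHS]aE -heapA heapKl.
Qed.

Let subHeap_rel_op3 x y z z' :
  subHeap_rel z z' -> subHeap_rel [hp x, y, z] [hp x, y, z'].
Proof.
move=> [s Ss Szzs]; exists s => //.
by rewrite heap_mid -(heapA x) (heapC x) -(heapA z z' y) heapKl -heapA heapKl.
Qed.

Let subHeap_rel_op2 x y y' z :
  subHeap_rel y y' -> subHeap_rel [hp x, y, z] [hp x, y', z].
Proof.
move=> /subHeap_rel_sym[s Ss Szzs]; exists s => //.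
by rewrite heap_mid -(heapA x) heapKl (heapC x) -heapA heapKl.
Qed.

Lemma subHeap_rel_op x x' y y' z z' :
  subHeap_rel x x' -> subHeap_rel y y' -> subHeap_rel z z' ->
  subHeap_rel [hp x, y, z] [hp x', y', z'].
Proof.
move=> xx yy zz; apply: (subHeap_rel_trans (subHeap_rel_op3 x y zz)).
apply: (subHeap_rel_trans (subHeap_rel_op2 x z' yy)).
by rewrite (heapC x) (heapC x'); apply: subHeap_rel_op3.
Qed.

Definition quotient_repr (A : quotient) : H := sval (cid (quotient_pi_surj A)).

Lemma quotient_reprK (A : quotient) : quotient_pi (quotient_repr A) = A.
Proof. exact: svalP (cid (quotient_pi_surj A)). Qed.

(* Computed on chosen representatives; [quotient_opE] shows that the choice is
   irrelevant. *)
Definition quotient_op (A B C : quotient) : quotient :=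
  quotient_pi [hp quotient_repr A, quotient_repr B, quotient_repr C].

Lemma quotient_opE x y z :
  quotient_op (quotient_pi x) (quotient_pi y) (quotient_pi z) =
  quotient_pi [hp x, y, z].
Proof.
by apply/quotient_piP/subHeap_rel_op; apply/quotient_piP/quotient_reprK.
Qed.

Let quotient_nonempty : inhabited quotient.
Proof. by have [x] := @heap_nonempty H; split; exact: quotient_pi. Qed.

Let quotient_opA (A B C D E : quotient) :
  quotient_op A B (quotient_op C D E) = quotient_op (quotient_op A B C) D E.
Proof.
rewrite -(quotient_reprK A) -(quotient_reprK B) -(quotient_reprK C).
by rewrite -(quotient_reprK D) -(quotient_reprK E) !quotient_opE heapA.
Qed.

Let quotient_opKl (A B : quotient) : quotient_op A A B = B.
Proof.
by rewrite -(quotient_reprK A) -(quotient_reprK B) quotient_opE heapKl.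
Qed.

Let quotient_opKr (A B : quotient) : quotient_op B A A = B.
Proof.
by rewrite -(quotient_reprK A) -(quotient_reprK B) quotient_opE heapKr.
Qed.

HB.instance Definition _ := isHeap.Build quotient
  quotient_nonempty quotient_opA quotient_opKl quotient_opKr.

Let quotient_opC (A B C : quotient) : [hp A, B, C] = [hp C, B, A].
Proof.
rewrite -(quotient_reprK A) -(quotient_reprK B) -(quotient_reprK C).
by rewrite /heap_op /= !quotient_opE heapC.
Qed.

HB.instance Definition _ := Heap_isAbelian.Build quotient quotient_opC.

Lemma quotient_piE x y z :
  quotient_pi [hp x, y, z] =
  [hp quotient_pi x, quotient_pi y, quotient_pi z].
Proof. by rewrite -quotient_opE. Qed.

End Quotient.

Definition paragon (T : trussType) (P : subHeap T) : Prop :=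
  forall x p p' : T, P p -> P p' ->
    P [hp x * p, x * p', p'] /\ P [hp p * x, p' * x, p'].

(* Main.v *)
Require Import Defs.
From mathcomp Require Import ssreflect ssrfun ssrbool.
From mathcomp Require Import monoid.

(* For [p] in [P], the elements equivalent to [p] are exactly those of [P], so
   the paragon condition says that multiplying two elements of [P] by [x] gives
   equivalent elements.  If [x ~ y] and [s] is in [P], then [p := [x, y, s]] is
   in [P] and distributivity gives [[w p, w s, s] = [w x, w y, s]]; hence the
   paragon condition is equivalent to [~] being a congruence for the
   multiplication. *)

Local Open Scope group_scope.

Lemma subHeap_rel_mem (H : abHeapType) (S : subHeap H) (p p' : H) :
  S p -> S p' -> subHeap_rel S p p'.
Proof. by move=> Sp Sp'; exists p' => //; apply: subHeap_closed. Qed.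

Section TrussQuotient.
Variables (T : trussType) (P : subHeap T).
Implicit Types w x y z : T.

Lemma truss_mulA : associative (@mul T).
Proof. by have [] := @trussP T. Qed.

Lemma truss_mulhDr w x y z : w * [hp x, y, z] = [hp w * x, w * y, w * z].
Proof. by have [_ ->] := @trussP T. Qed.

Lemma truss_mulhDl w x y z : [hp x, y, z] * w = [hp x * w, y * w, z * w].
Proof. by have [_ _ ->] := @trussP T. Qed.

Hypothesis paragonP : paragon P.

Lemma paragon_rel_mull w x y :
  subHeap_rel P x y -> subHeap_rel P (w * x) (w * y).
Proof.
move=> [s Ps Pxys]; exists s => //.
have [+ _] := paragonP w _ _ Pxys Ps.
by rewrite truss_mulhDr -heapA heapKl.
Qed.

Lemma paragon_rel_mulr w x y :
  subHeap_rel P x y -> subHeap_rel P (x * w) (y * w).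
Proof.
move=> [s Ps Pxys]; exists s => //.
have [_] := paragonP w _ _ Pxys Ps.
by rewrite truss_mulhDl -heapA heapKl.
Qed.

(** Computed on chosen representatives; for a paragon [P], [quotient_mulE] shows that the choice is
    irrelevant. *)
Definition quotient_mul (A B : quotient P) : quotient P :=
  quotient_pi P (quotient_repr A * quotient_repr B).

Lemma quotient_mulE x y :
  quotient_mul (quotient_pi P x) (quotient_pi P y) = quotient_pi P (x * y).
Proof.
apply/quotient_piP.
(* The representatives are replaced one factor at a time, through this mixed product. *)
apply: (@subHeap_rel_trans _ _ _ (x * quotient_repr (quotient_pi P y))).
  exact/paragon_rel_mulr/quotient_piP/quotient_reprK.
exact/paragon_rel_mull/quotient_piP/quotient_reprK.
Qed.

(** Every class is the image of its representative, so each law descends from [T]. *)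
Lemma quotient_mul_truss : truss_axioms quotient_mul.
Proof.
split=> [A B C|D A B C|D A B C].
- rewrite -(quotient_reprK A) -(quotient_reprK B) -(quotient_reprK C).
  by rewrite !quotient_mulE truss_mulA.
- rewrite -(quotient_reprK A) -(quotient_reprK B) -(quotient_reprK C).
  rewrite -(quotient_reprK D) -quotient_piE !quotient_mulE -quotient_piE.
  by rewrite truss_mulhDr.
- rewrite -(quotient_reprK A) -(quotient_reprK B) -(quotient_reprK C).
  rewrite -(quotient_reprK D) -quotient_piE !quotient_mulE -quotient_piE.
  by rewrite truss_mulhDl.
Qed.

End TrussQuotient.

Theorem proposition3p22 (T : trussType) (P : subHeap T) :
  (exists (mul : quotient P -> quotient P -> quotient P)
          (mulP : truss_axioms mul),
     truss_morphism (quotient_pi P : T -> truss_of mulP))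
  <-> paragon P.
Proof.
split=> [[mul [mulP [_ piM]]] x p p' Pp Pp'|paragonP].
  have epp' : quotient_pi P p = quotient_pi P p'.
    exact/quotient_piP/subHeap_rel_mem.
  (* Equivalence can be tested at any element of [P], here [p'], so both memberships reduce to equal
     classes of the two products. *)
  split; apply: subHeap_rel_all (Pp'); apply/quotient_piP.
    by rewrite (piM x p) (piM x p') epp'.
  by rewrite (piM p x) (piM p' x) epp'.
exists (quotient_mul T P), (quotient_mul_truss T P paragonP); split.
  exact: quotient_piE.
(* The product of [truss_of] is [quotient_mul] by conversion. *)
by move=> x y; rewrite -quotient_mulE.
Qed.
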